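(* For $i,j,n\ge 0$ let $q(i,j,n)$ be the number of walks with $n$ steps, each in $\{(1,0),(-1,0),(0,1),(0,-1)\}$, that start at $(0,0)$, end at $(i,j)$, and stay in the quarter plane $\mathbb{Z}_+^2=\{0,1,2,\dots\}^2$. Then, as $n\to\infty$, $$\sum_{i\ge 0}q(i,0,n)\sim\frac{8}{\pi}\,\frac{4^{n}}{n^{2}} .$$
   Context: Here $f(n)\sim g(n)$ means $f(n)/g(n)\to 1$ as $n\to\infty$. *)

(* Defs.v *)
(* Mathematical Components with MathComp-Analysis. *)
From HB Require Import structures.
From mathcomp Require Import all_boot all_order all_algebra.
From mathcomp Require Import all_classical all_reals all_analysis.

Set Implicit Arguments.
Unset Strict Implicit.
Unset Printing Implicit Defensive.

Import Order.TTheory GRing.Theory Num.Theory.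
Import numFieldNormedType.Exports.

Local Open Scope ring_scope.

Definition steps : seq (int * int) :=
  [:: (1, 0); (-1, 0); (0, 1); (0, -1)].

(* The finite type whose elements are the four members of [steps]. *)
Definition step : finType := seq_sub steps.

Definition position (w : seq step) : int * int := \sum_(s <- w) val s.

Definition in_quarter_plane (p : int * int) : bool := (0 <= p.1) && (0 <= p.2).

(* [take k w], for [k] from 0 to [n], runs over all prefixes of the walk, so
   every visited point, both endpoints included, lies in the quarter plane. *)
Definition quarter_walk (n : nat) (w : n.-tuple step) : bool :=
  [forall k : 'I_n.+1, in_quarter_plane (position (take k w))].

Definition q (i j n : nat) : nat :=
  #|[set w : n.-tuple step |
      quarter_walk w && (position w == (i%:Z, j%:Z))]|.

(* Only finitely many [i] contribute to the sum over all endpoints [(i, 0)];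
   in particular the infinite sum over [i] converges. *)
Lemma q_gt (i j n : nat) : (n < i)%N -> q i j n = 0%N.
Proof.
move=> lt_ni; apply: eq_card0 => w; rewrite inE; apply/negP => /andP[_ /eqP].
have le_pos (s : seq step) : (position s).1 <= (size s)%:Z.
  elim: s => [|x s IHs]; first by rewrite /position big_nil.
  rewrite /position big_cons /= -add1n PoszD lerD //.
  by case: x => x /=; rewrite !inE => /or4P[] /eqP->.
move=> posE; have := le_pos w; rewrite posE size_tuple /= lez_nat.
by rewrite leqNgt lt_ni.
Qed.

(* Main.v *)
(* By the reflection principle in the lines x = -1 and y = -1, the number of
   quarter-plane walks ending at (a, b) is an alternating sum of four numbers of
   unconstrained walks, each of which is a product of two binomial coefficients
   after a rotation by 45 degrees.  For b = 0 the sum over a telescopes, leaving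
   for n = 2m the value C(2m, m)^2 (2m + 1) / (m + 1)^2, and for n = 2m + 1 the
   value C(2m + 2, m + 1)^2 / (2 (m + 2)).  Wallis' inequalities for the central
   binomial coefficients then show that the ratio in the theorem lies between
   1 - 5 / (n + 1) and 1. *)
Require Import Defs.
From mathcomp Require Import all_boot all_order all_algebra.
From mathcomp Require Import all_classical all_reals all_analysis.
From mathcomp Require Import ring lra zify.

Import Order.TTheory GRing.Theory Num.Theory.
Import numFieldNormedType.Exports.

Local Open Scope ring_scope.

(** * Counting walks by their last step *)

Lemma big_steps (V : nmodType) (f : int * int -> V) :
  \sum_(s : step) f (val s) = \sum_(x <- steps) f x.
Proof.
rewrite -(big_map val xpredT f).
apply: perm_big; apply: uniq_perm => //.
  by rewrite map_inj_uniq ?index_enum_uniq //; exact: val_inj.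
move=> x; apply/mapP/idP => [[s _ ->]|xs]; first exact: valP.
by exists (SeqSub xs) => //; rewrite mem_index_enum.
Qed.

Lemma position_rcons (w : seq step) (s : step) :
  position (rcons w s) = position w + val s.
Proof. by rewrite /position -cats1 big_cat big_seq1. Qed.

Lemma quarter_walk_rcons (n : nat) (w : n.-tuple step) (s : step) :
  quarter_walk [tuple of rcons w s] =
  quarter_walk w && in_quarter_plane (position w + val s).
Proof.
apply/forallP/andP => [H|[/forallP H Hs] k].
  split; last first.
    have := H ord_max; rewrite take_oversize ?size_tuple //.
    by rewrite position_rcons.
  apply/forallP => k; have := H (widen_ord (leqnSn _) k).
  by rewrite /= -cats1 takel_cat // size_tuple -ltnS.
have [lekn|ltnk] := leqP k n.
  have := H (Ordinal (lekn : (k < n.+1)%N)).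
  by rewrite /= -cats1 takel_cat // size_tuple.
by rewrite take_oversize /= ?size_rcons ?size_tuple // position_rcons.
Qed.

(** Endpoints range over all integer points, unlike in [q], so that the recurrence on the last step
    may look outside the quarter plane. *)
Definition walks_to (p : int * int) (n : nat) : nat :=
  #|[set w : n.-tuple step | quarter_walk w && (position w == p)]|.

Lemma walks_to_out (p : int * int) (n : nat) :
  ~~ in_quarter_plane p -> walks_to p n = 0%N.
Proof.
move=> pN; apply: eq_card0 => w; rewrite inE; apply/negP => /andP[wq].
have /forallP/(_ ord_max) := wq.
rewrite take_oversize ?size_tuple // => posq /eqP posE.
by rewrite posE (negPf pN) in posq.
Qed.

Lemma rcons_tuple_bij (T : finType) (n : nat) :
  bijective (fun ws : n.-tuple T * T => [tuple of rcons ws.1 ws.2]).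
Proof.
apply: inj_card_bij; last by rewrite card_prod !card_tuple expnSr.
move=> [w s] [w' s'] /(congr1 val)/= /rcons_inj[ww' ->].
by congr pair; exact: val_inj.
Qed.

Lemma walks_toS (p : int * int) (n : nat) : in_quarter_plane p ->
  walks_to p n.+1 = (\sum_(s <- steps) walks_to (p - s)%R n)%N.
Proof.
move=> pq; rewrite -[RHS](big_steps nat) /walks_to -sum1dep_card.
rewrite (reindex _ (onW_bij _ (rcons_tuple_bij _ n))) /=.
(* In [pair_big_dep], [true] is the condition on the walk alone. *)
rewrite (eq_bigl (fun ws => true && (quarter_walk ws.1 &&
   (position ws.1 == p - val ws.2)))); last first.
  move=> [w s] /=; rewrite quarter_walk_rcons position_rcons eq_sym.
  rewrite [in RHS]eq_sym subr_eq -andbA.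
  by congr andb; case: eqP => [<-|]; rewrite ?pq ?andbF.
rewrite -(pair_big_dep xpredT 
  (fun (w : n.-tuple step) s => quarter_walk w && (position w == p - val s))
  (fun _ _ => 1%N)) (exchange_big_dep xpredT) //=.
by apply: eq_bigr => s _; rewrite sum1dep_card.
Qed.

(** * Free walks on the line and in the plane *)

(** Counts the [n]-step simple walks from 0 to [x]; integer-valued because the reflection formula
    subtracts. *)
Fixpoint line_walks (n : nat) (x : int) : int :=
  if n is n'.+1 then line_walks n' (x - 1) + line_walks n' (x + 1)
  else (x == 0)%:R.

Lemma line_walksN (n : nat) (x : int) : line_walks n (- x) = line_walks n x.
Proof.
elim: n x => [|n IHn] x /=; first by rewrite oppr_eq0.
rewrite addrC -(IHn (x - 1)) -(IHn (x + 1)).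
by congr (line_walks n _ + line_walks n _); lia.
Qed.

Lemma line_walks_gt (n : nat) (x : int) : n%:Z < `|x| -> line_walks n x = 0.
Proof.
elim: n x => [|n IHn] x /= nx; first by case: eqP nx => // ->.
by rewrite !IHn //; lia.
Qed.

(** Parity: after [n] steps the position has the parity of [n]. *)
Lemma line_walks_odd (n : nat) (k : int) : line_walks n (2 * k + 1 - n%:Z) = 0.
Proof.
elim: n k => [|n IHn] k /=; first by case: eqP => //; lia.
have -> : 2 * k + 1 - n.+1%:Z - 1 = 2 * (k - 1) + 1 - n%:Z by lia.
have -> : 2 * k + 1 - n.+1%:Z + 1 = 2 * k + 1 - n%:Z by lia.
by rewrite !IHn addr0.
Qed.

(** Ending at [2k - n] means [k] steps up and [n - k] down; the recurrence is Pascal's rule. *)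
Lemma line_walks_bin (n k : nat) :
  line_walks n (2 * k%:Z - n%:Z) = 'C(n, k)%:Z.
Proof.
elim: n k => [|n IHn] [|k] //=.
(* For [k = 0] the other neighbour, [-(n + 2)], is out of reach. *)
- have -> : 2 * 0%:Z - n.+1%:Z + 1 = 2 * 0%:Z - n%:Z by lia.
  by rewrite IHn line_walks_gt ?bin0 //; lia.
- have -> : 2 * k.+1%:Z - n.+1%:Z - 1 = 2 * k%:Z - n%:Z by lia.
  have -> : 2 * k.+1%:Z - n.+1%:Z + 1 = 2 * k.+1%:Z - n%:Z by lia.
  by rewrite !IHn binS PoszD addrC.
Qed.

(* In the coordinates a + b and a - b, a step of the plane walk is a pair of
   independent steps on the line. *)
Definition plane_walks (n : nat) (a b : int) : int :=
  line_walks n (a + b) * line_walks n (a - b).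

Lemma plane_walksS (n : nat) (a b : int) :
  plane_walks n.+1 a b = plane_walks n (a - 1) b + plane_walks n (a + 1) b +
    plane_walks n a (b - 1) + plane_walks n a (b + 1).
Proof.
rewrite /plane_walks /=.
have -> : a - 1 + b = a + b - 1 by lia.
have -> : a - 1 - b = a - b - 1 by lia.
have -> : a + 1 + b = a + b + 1 by lia.
have -> : a + 1 - b = a - b + 1 by lia.
have -> : a + (b - 1) = a + b - 1 by lia.
have -> : a - (b - 1) = a - b + 1 by lia.
have -> : a + (b + 1) = a + b + 1 by lia.
have -> : a - (b + 1) = a - b - 1 by lia.
ring.
Qed.

Lemma plane_walksNl (n : nat) (a b : int) :
  plane_walks n (- a) b = plane_walks n a b.
Proof.
rewrite /plane_walks mulrC.
rewrite -(line_walksN _ (- a - b)) -(line_walksN _ (- a + b)).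
by congr (line_walks _ _ * line_walks _ _); lia.
Qed.

Lemma plane_walksNr (n : nat) (a b : int) :
  plane_walks n a (- b) = plane_walks n a b.
Proof. by rewrite /plane_walks opprK mulrC. Qed.

(** * The reflection principle in the quarter plane *)

(** Reflection in x = -1 sends [a] to [-a - 2]; as [plane_walks] is even in each coordinate, the
    image is written [a + 2]. Likewise for [b]. *)
Definition reflected_walks (n : nat) (a b : int) : int :=
  plane_walks n a b - plane_walks n (a + 2) b
  - plane_walks n a (b + 2) + plane_walks n (a + 2) (b + 2).

Lemma reflected_walksS (n : nat) (a b : int) :
  reflected_walks n.+1 a b =
  reflected_walks n (a - 1) b + reflected_walks n (a + 1) b +
  reflected_walks n a (b - 1) + reflected_walks n a (b + 1).
Proof.
rewrite /reflected_walks !plane_walksS.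
rewrite ![_ - 1 + 2]addrAC ![_ + 1 + 2]addrAC; ring.
Qed.

(* Both sides vanish on the lines a = -1 and b = -1, the right-hand side by
   symmetry, and satisfy the same recurrence inside the quarter plane. *)
Lemma walks_toE (n : nat) (a b : int) : -1 <= a -> -1 <= b ->
  (walks_to (a, b) n)%:Z = reflected_walks n a b.
Proof.
elim: n a b => [|n IHn] a b a_ge b_ge.
all: have [a0|a0] := boolP (0 <= a); last first.
1,3: have -> : a = -1 by lia.
1,2: rewrite walks_to_out // /reflected_walks.
1,2: have -> : -1 + 2 = 1 :> int by [].
1,2: by rewrite !plane_walksNl; ring.
all: have [b0|b0] := boolP (0 <= b); last first.
1,3: have -> : b = -1 by lia.
1,2: rewrite walks_to_out ?/in_quarter_plane ?andbF // /reflected_walks.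
1,2: have -> : -1 + 2 = 1 :> int by [].
1,2: by rewrite !plane_walksNr; ring.
- have -> : walks_to (a, b) 0 = ((a == 0) && (b == 0)).
    rewrite /walks_to; case: (boolP (_ && _)) => [/andP[/eqP-> /eqP->]|abN].
      rewrite (_ : [set _ | _]%SET = [set: 0.-tuple step]%SET).
        by rewrite cardsT card_tuple.
      apply/setP => w; rewrite !inE tuple0 /=.
      apply/andP; split; last by rewrite /position big_nil.
      by apply/forallP => k; rewrite /position big_nil.
    apply: eq_card0 => w; rewrite inE tuple0 /= /position big_nil.
    apply/negP => /andP[_]; rewrite eq_sym xpair_eqE.
    by rewrite (negPf abN).
  rewrite /reflected_walks /plane_walks /=.
  (* No reflected endpoint is the origin: each reflected product has a zero factor. *)
  have -> : (a + 2 + b == 0) = false by lia.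
  have -> : (a + (b + 2) == 0) = false by lia.
  have -> : (a + 2 + (b + 2) == 0) = false by lia.
  rewrite /= !mul0r !subr0.
  by do ![case: eqP => ?] => //=; lia.
- rewrite walks_toS ?/in_quarter_plane ?a0 ?b0 //.
  (* The neighbours have coordinates at least -1, hence the range of [a] and [b] in the
     statement. *)
  rewrite !big_cons big_nil reflected_walksS -!IHn; try lia.
  rewrite /steps /=.
  have pE (x y u v : int) : (x, y) - (u, v) = (x - u, y - v) by [].
  rewrite !pE !subr0 !opprK !PoszD; ring.
Qed.

(** * Telescoping along the axis *)

Lemma sum_walks (n : nat) :
  (\sum_(0 <= i < n.+1) q i 0 n)%N%:Z =
  line_walks n 0 ^+ 2 + line_walks n 1 ^+ 2 - line_walks n 2 ^+ 2
  - line_walks n 3 * line_walks n 1.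
Proof.
(* The summand is a difference with shift 2 in [i]; adding two consecutive terms makes it a
   difference with shift 1. *)
pose g (i : nat) := plane_walks n i%:Z 2 - plane_walks n i%:Z 0 +
  (plane_walks n i.+1%:Z 2 - plane_walks n i.+1%:Z 0).
have -> : (\sum_(0 <= i < n.+1) q i 0 n)%N%:Z =
    \sum_(0 <= i < n.+1) (g i.+1 - g i).
  rewrite (big_morph Posz PoszD (erefl _)).
  apply: eq_bigr => i _.
  rewrite -[q i 0 n]/(walks_to (i%:Z, 0) n) walks_toE //.
  rewrite /g /reflected_walks.
  have -> : i.+2%:Z = i%:Z + 2 by lia.
  have -> : 0 + 2 = 2 :> int by [].
  ring.
(* Points out of reach: the upper end [g n.+1] vanishes and [- g 0] remains. *)
have far (j : nat) (b : int) : (n < j)%N -> 0 <= b -> plane_walks n j%:Z b = 0.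
  by move=> nj b0; rewrite /plane_walks line_walks_gt ?mul0r //; lia.
rewrite telescope_sumr // /g !(far n.+1) // !(far n.+2) //.
have -> : plane_walks n 0%:Z 2 = line_walks n 2 ^+ 2.
  by rewrite /plane_walks (line_walksN n 2).
have -> : plane_walks n 0%:Z 0 = line_walks n 0 ^+ 2 by [].
have -> : plane_walks n 1%:Z 2 = line_walks n 3 * line_walks n 1.
  by rewrite /plane_walks (line_walksN n 1).
have -> : plane_walks n 1%:Z 0 = line_walks n 1 ^+ 2 by [].
ring.
Qed.

(** * Wallis' integrals *)

Local Open Scope classical_set_scope.

(* The reduction formula for the integral of cos^n, read as a definition of the
   primitive vanishing at 0; Wallis' integrals are its values at pi / 2. *)
Fixpoint cosX_primitive (R : realType) (n : nat) : R -> R :=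
  match n with
  | 0 => id
  | 1 => sin
  | (m.+1 as m1).+1 =>
      fun x => (cos x ^+ m1 * sin x + m1%:R * cosX_primitive R m x) / m.+2%:R
  end.

(** For [n + 2], the numerator has derivative cos^(n+2) - (n+1) cos^n sin^2 + (n+1) cos^n, which
    sin^2 = 1 - cos^2 turns into (n+2) cos^(n+2). *)
Lemma is_derive_cosX_primitive (R : realType) (n : nat) (x : R) :
  is_derive x 1 (cosX_primitive R n) (cos x ^+ n).
Proof.
have [m] := ubnP n; elim: m n => // m IHm [|[|n]] ltnm.
- by rewrite expr0; exact: is_derive_id.
- by rewrite expr1; exact: is_derive_sin.
have dF : is_derive x 1 (cosX_primitive R n) (cos x ^+ n) by apply: IHm; lia.
have -> : cosX_primitive R n.+2 = n.+2%:R^-1 *: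
    ((@cos R) ^+ n.+1 * @sin R + n.+1%:R *: cosX_primitive R n).
  by apply/funext => y; rewrite !fctE /= mulrC.
have dcos := is_deriveX n.+1 (is_derive_cos x).
have dprod := is_deriveM dcos (is_derive_sin x).
have dsum := is_deriveD dprod (is_deriveZ n.+1%:R dF).
apply: (is_derive_eq (is_deriveZ n.+2%:R^-1 dsum)).
rewrite -[_ *: _]/(_ * _) /GRing.scale /= fctE.
have -> : sin x * (n.+1%:R * cos x ^+ n * - sin x) =
    - (n.+1%:R * cos x ^+ n * sin x ^+ 2) by ring.
have n2_neq0 : n.+2%:R != 0 :> R by rewrite pnatr_eq0.
apply: (mulfI n2_neq0).
rewrite mulrA divff // mul1r sin2cos2 -[n.+2%:R]natr1 !exprS; ring.
Qed.

Lemma cosX_primitive0 (R : realType) (n : nat) : cosX_primitive R n 0 = 0.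
Proof.
have [m] := ubnP n; elim: m n => // m IHm [|[|n]] ltnm //=; first exact: sin0.
by rewrite sin0 IHm ?mulr0 ?addr0 ?mul0r //; lia.
Qed.

Definition wallis (R : realType) (n : nat) : R := cosX_primitive R n (pi / 2).

Lemma wallisSS (R : realType) (n : nat) :
  wallis R n.+2 = n.+1%:R / n.+2%:R * wallis R n.
Proof. by rewrite /wallis /= cos_pihalf expr0n mul0r add0r mulrAC. Qed.

Lemma wallis_gt0 (R : realType) (n : nat) : 0 < wallis R n.
Proof.
have [m] := ubnP n; elim: m n => // m IHm [|[|n]] ltnm.
- by rewrite /wallis /= divr_gt0 ?pi_gt0.
- by rewrite /wallis /= sin_pihalf.
- by rewrite wallisSS mulr_gt0 ?divr_gt0 ?ltr0n ?IHm //; lia.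
Qed.

(** On [0, pi/2] the powers of cos decrease with the exponent, so the difference of the two
    primitives is nondecreasing from its value 0 at 0. *)
Lemma wallis_nincr (R : realType) (n : nat) : wallis R n.+1 <= wallis R n.
Proof.
have pi2 : 0 <= pi / 2 :> R by rewrite divr_ge0 ?pi_ge0.
have dF k (x : R) := is_derive_cosX_primitive R k x.
pose F := cosX_primitive R n - cosX_primitive R n.+1.
have dG (x : R) : is_derive x 1 F (cos x ^+ n - cos x ^+ n.+1).
  exact: is_deriveB.
have cF : {within `[0, pi / 2], continuous F}.
  apply: continuous_subspaceT => x.
  by apply: differentiable_continuous; apply/derivable1_diffP.
have : F 0 <= F (pi / 2).
  apply: (@ger0_derive1_le_cc _ F 0 (pi / 2)) => //.
  - move=> x; rewrite in_itv /= => /andP[x0 xpi].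
    rewrite derive1E (@derive_val _ _ _ _ _ _ _ (dG x)) subr_ge0 exprS.
    rewrite ger_pMl ?cos_le1 // exprn_gt0 // cos_gt0_pihalf // xpi andbT.
    by rewrite (lt_trans _ x0) // oppr_lt0 divr_gt0 ?pi_gt0.
  - by rewrite in_itv /= lexx.
  - by rewrite in_itv /= lexx andbT.
by rewrite /F !fctE !cosX_primitive0 subrr subr_ge0.
Qed.

(** By [wallisSS] the left-hand side does not depend on [n]. *)
Lemma wallisM (R : realType) (n : nat) :
  n.+1%:R * (wallis R n * wallis R n.+1) = pi / 2.
Proof.
elim: n => [|n IHn]; first by rewrite /wallis /= sin_pihalf mul1r mulr1.
by rewrite -IHn wallisSS; field; rewrite -(natrD _ 2) pnatr_eq0.
Qed.

(** Monotonicity compares the square with the products in [wallisM] at [n] and at [n - 1]. *)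
Lemma wallis_sqr_bounds (R : realType) (n : nat) :
  pi / 2 <= n.+1%:R * wallis R n ^+ 2 /\ n%:R * wallis R n ^+ 2 <= pi / 2.
Proof.
split.
  rewrite -(wallisM R n) ler_pM2l ?ltr0n // expr2 ler_pM2l ?wallis_gt0 //.
  exact: wallis_nincr.
case: n => [|n]; first by rewrite mul0r divr_ge0 ?pi_ge0.
rewrite -(wallisM R n) ler_pM2l ?ltr0n // expr2 ler_pM2r ?wallis_gt0 //.
exact: wallis_nincr.
Qed.

(** * Central binomial coefficients *)

Lemma central_binS (m : nat) :
  (m.+1 * 'C(m.+1.*2, m.+1) = 2 * (m.*2.+1 * 'C(m.*2, m)))%N.
Proof.
have h1 := mul_bin_diag m.*2.+2 m.
have h2 := mul_bin_down m.*2.+1 m.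
rewrite /= in h1 h2.
rewrite doubleS -h1.
have -> : (m.*2.+2 * 'C(m.*2.+1, m) =
    2 * ((m.*2.+1 - m) * 'C(m.*2.+1, m)))%N by lia.
by rewrite -h2.
Qed.

(** Passing from [m] to [m + 1] multiplies both sides by (2m+1)/(2m+2). *)
Lemma wallis_double (R : realType) (m : nat) :
  wallis R m.*2 = 'C(m.*2, m)%:R / 4 ^+ m * (pi / 2).
Proof.
elim: m => [|m IHm]; first by rewrite /wallis /= bin0 expr0 divr1 mul1r.
have : m.+1%:R * 'C(m.+1.*2, m.+1)%:R =
    2 * (m.*2.+1%:R * 'C(m.*2, m)%:R) :> R.
  by rewrite -!natrM central_binS.
rewrite doubleS wallisSS IHm exprS.
have m1 : m.+1%:R != 0 :> R by rewrite pnatr_eq0.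
move=> /(canRL (mulKf m1)) ->.
have -> : m.*2.+2%:R = 2 * m.+1%:R :> R by rewrite -natrM mul2n.
by field; rewrite ?expf_neq0 //= addrC natr1.
Qed.

Lemma central_bin_bounds (R : realType) (m : nat) :
  let t := pi / 2 * ('C(m.*2, m)%:R / 4 ^+ m) ^+ 2 : R in
  1 <= m.*2.+1%:R * t /\ m.*2%:R * t <= 1.
Proof.
have pi2 : 0 < pi / 2 :> R by rewrite divr_gt0 ?pi_gt0.
move=> t; have tE : wallis R m.*2 ^+ 2 = t * (pi / 2).
  by rewrite wallis_double /t; ring.
have := wallis_sqr_bounds R m.*2; rewrite tE => -[lo hi].
by split; rewrite -(ler_pM2r pi2) mul1r -mulrA.
Qed.

(** * Closed forms for walks ending on the axis *)

Definition axis_walks (n : nat) : nat := (\sum_(0 <= i < n.+1) q i 0 n)%N.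

(** Parity leaves C(2m, m)^2 - C(2m, m+1)^2, and C(2m, m+1) = m/(m+1) C(2m, m). *)
Lemma axis_walks_even (R : realType) (m : nat) :
  (axis_walks m.*2)%:R =
  'C(m.*2, m)%:R ^+ 2 * m.*2.+1%:R / m.+1%:R ^+ 2 :> R.
Proof.
have m1 : m.+1%:R != 0 :> R by rewrite pnatr_eq0.
rewrite pmulrn /axis_walks sum_walks.
have -> : line_walks m.*2 0 = 'C(m.*2, m)%:Z.
  by rewrite -line_walks_bin; congr line_walks; lia.
have -> : line_walks m.*2 1 = 0.
  by rewrite -[RHS](line_walks_odd m.*2 m%:Z); congr line_walks; lia.
have -> : line_walks m.*2 2 = 'C(m.*2, m.+1)%:Z.
  by rewrite -line_walks_bin; congr line_walks; lia.
have := mul_bin_left m.*2 m.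
rewrite -addnn addnK => /(congr1 (fun k => k%:R : R)).
rewrite !natrM => /(canRL (mulKf m1)) binE.
rewrite expr0n mulr0 addr0 subr0 rmorphB !rmorphXn /= -!pmulrn binE.
by field; rewrite addrC natr1.
Qed.

(** With c = C(2m+1, m+1), parity leaves c^2 - c C(2m+1, m+2). Here C(2m+1, m+2) = m/(m+2) c and
    C(2m+2, m+1) = 2c. *)
Lemma axis_walks_odd (R : realType) (m : nat) :
  (axis_walks m.*2.+1)%:R =
  'C(m.+1.*2, m.+1)%:R ^+ 2 / (2 * m.+2%:R) :> R.
Proof.
have m2 : m.+2%:R != 0 :> R by rewrite pnatr_eq0.
rewrite pmulrn /axis_walks sum_walks.
have -> : line_walks m.*2.+1 0 = 0.
  by rewrite -[RHS](line_walks_odd m.*2.+1 m%:Z); congr line_walks; lia.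
have -> : line_walks m.*2.+1 1 = 'C(m.*2.+1, m.+1)%:Z.
  by rewrite -line_walks_bin; congr line_walks; lia.
have -> : line_walks m.*2.+1 2 = 0.
  by rewrite -[RHS](line_walks_odd m.*2.+1 m.+1%:Z); congr line_walks; lia.
have -> : line_walks m.*2.+1 3 = 'C(m.*2.+1, m.+2)%:Z.
  by rewrite -line_walks_bin; congr line_walks; lia.
have := mul_bin_left m.*2.+1 m.+1.
have -> : (m.*2.+1 - m.+1 = m)%N by lia.
move=> /(congr1 (fun k => k%:R : R)).
rewrite !natrM => /(canRL (mulKf m2)) binE.
have -> : 'C(m.+1.*2, m.+1)%:R = 2 * 'C(m.*2.+1, m.+1)%:R :> R.
  rewrite doubleS binS natrD.
  have -> : 'C(m.*2.+1, m) = 'C(m.*2.+1, m.+1).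
    by rewrite -bin_sub; [congr binomial; lia | lia].
  by ring.
rewrite expr0n add0r subr0 rmorphB rmorphXn rmorphM /= -!pmulrn binE.
by field; rewrite -(natrD _ 2) pnatr_eq0.
Qed.

(** * Explicit bounds on the ratio *)

Definition axis_ratio (R : realType) (n : nat) : R :=
  (axis_walks n)%:R / (8 / pi * (4 ^+ n / n%:R ^+ 2)).

(** Isolates the quantity [t] bounded in [central_bin_bounds]. *)
Lemma axis_ratio_even (R : realType) (m : nat) : (0 < m)%N ->
  axis_ratio R m.*2 = m.*2.+1%:R * (pi / 2 * ('C(m.*2, m)%:R / 4 ^+ m) ^+ 2)
    * (m%:R / (m%:R + 1)) ^+ 2.
Proof.
move=> m_gt0; rewrite /axis_ratio axis_walks_even.
have m0 : m%:R != 0 :> R by rewrite pnatr_eq0 -lt0n.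
have m1 : m%:R + 1 != 0 :> R by rewrite natr1 pnatr_eq0.
have p0 : pi != 0 :> R by rewrite gt_eqF ?pi_gt0.
have f0 : 4 ^+ m != 0 :> R by rewrite expf_neq0 ?pnatr_eq0.
rewrite -[m.+1%:R]natr1.
have -> : m.*2%:R = 2 * m%:R :> R by rewrite -mul2n natrM.
have -> : 4 ^+ m.*2 = (4 ^+ m) ^+ 2 :> R by rewrite -muln2 exprM.
move: (pi : R) p0 (4 ^+ m) f0 => p p0 f f0.
by field; rewrite m1 f0 m0 p0.
Qed.

Lemma axis_ratio_odd (R : realType) (m : nat) :
  axis_ratio R m.*2.+1 =
  (pi / 2 * ('C(m.+1.*2, m.+1)%:R / 4 ^+ m.+1) ^+ 2)
    * m.*2.+1%:R ^+ 2 / (2 * m.+2%:R).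
Proof.
rewrite /axis_ratio axis_walks_odd.
have n0 : m.*2.+1%:R != 0 :> R by rewrite pnatr_eq0.
have m2 : m.+2%:R != 0 :> R by rewrite pnatr_eq0.
have p0 : pi != 0 :> R by rewrite gt_eqF ?pi_gt0.
have f0 : 4 ^+ m != 0 :> R by rewrite expf_neq0 ?pnatr_eq0.
have -> : 4 ^+ m.*2.+1 = 4 * (4 ^+ m) ^+ 2 :> R by rewrite exprS -muln2 exprM.
rewrite [4 ^+ m.+1]exprS.
move: (pi : R) p0 (4 ^+ m) f0 => p p0 f f0.
move: (m.*2.+1%:R : R) n0 (m.+2%:R : R) m2 => n n0 k k0.
by field; rewrite f0 n0 p0 k0.
Qed.

Lemma axis_ratio_bounds (R : realType) (n : nat) : (0 < n)%N ->
  1 - 5 / n.+1%:R <= axis_ratio R n <= 1.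
Proof.
have [m [] ->] : exists m, n = m.*2 \/ n = m.*2.+1.
- by exists n./2; lia.
- rewrite double_gt0 => m_gt0; rewrite axis_ratio_even //.
  have [] := central_bin_bounds R m.
  move: (pi / 2 * _ : R) => t.
  rewrite -[m.*2.+1%:R]natr1 -mul2n natrM.
  have : 0 < m%:R :> R by rewrite ltr0n.
  move: (m%:R : R) => M M0 lo hi.
  have M1 : 0 < M + 1 by lra.
  have M21 : 0 < 2 * M + 1 by lra.
  rewrite expr_div_n mulrA ler_pdivrMr ?exprn_gt0 // mul1r.
  rewrite ler_pdivlMr ?exprn_gt0 //.
  have -> : 1 - 5 / (2 * M + 1) = (2 * M - 4) / (2 * M + 1) by field; lra.
  apply/andP; split.
    apply: (@le_trans _ _ (M ^+ 2)); last by rewrite ler_peMl ?sqr_ge0.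
    by rewrite mulrAC ler_pdivrMr //; nra.
  (* Brings out the factor [2 * M * t], at most 1 by [hi]. *)
  have -> : (2 * M + 1) * t * M ^+ 2 = (2 * M * t) * ((2 * M + 1) * M / 2).
    by field.
  apply: (@le_trans _ _ ((2 * M + 1) * M / 2)); last by nra.
  by rewrite ger_pMl //; nra.
- move=> _; rewrite axis_ratio_odd.
  have [] := central_bin_bounds R m.+1.
  move: (pi / 2 * _ : R) => t.
  rewrite doubleS -[m.*2.+3%:R]natr1 -[m.*2.+2%:R]natr1 -[m.*2.+1%:R]natr1.
  rewrite -[m.+2%:R]natr1 -[m.+1%:R]natr1 -mul2n natrM.
  have : 0 <= m%:R :> R by rewrite ler0n.
  move: (m%:R : R) => M M0 lo hi.
  have d0 : 0 < 2 * (M + 1 + 1) by lra.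
  have n0 : 0 < 2 * M + 2 by lra.
  have k0 : 0 < 2 * M + 3 by lra.
  rewrite ler_pdivrMr // mul1r ler_pdivlMr //.
  have -> : 1 - 5 / (2 * M + 1 + 1) = (2 * M - 3) / (2 * M + 2) by field; lra.
  apply/andP; split.
    rewrite mulrAC ler_pdivrMr // -(ler_pM2l k0).
    have -> : (2 * M + 3) * (t * (2 * M + 1) ^+ 2 * (2 * M + 2)) =
      ((2 * M + 1 + 1 + 1) * t) * ((2 * M + 1) ^+ 2 * (2 * M + 2)) by ring.
    (* The constant 5 comes from here: with it the cubic and quadratic terms in [M] agree on both
       sides. *)
    apply: (@le_trans _ _ ((2 * M + 1) ^+ 2 * (2 * M + 2))); first by nra.
    by rewrite ler_peMl //; nra.
  rewrite -(ler_pM2l n0).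
  have -> : (2 * M + 2) * (t * (2 * M + 1) ^+ 2) =
    ((2 * M + 1 + 1) * t) * (2 * M + 1) ^+ 2 by ring.
  apply: (@le_trans _ _ ((2 * M + 1) ^+ 2)); last by nra.
  by rewrite ger_pMl //; nra.
Qed.

(** * The infinite sum and the limit *)

(** By [q_gt] the partial sums are constant from [n.+1] terms on. *)
Lemma axis_walks_series (R : realType) (n : nat) :
  \big[+%R/0]_(0 <= i <oo) ((q i 0 n)%:R : R) = (axis_walks n)%:R.
Proof.
apply: lim_near_cst => //; near=> N.
have nN : (n.+1 <= N)%N by near: N; exact: nbhs_infty_ge.
rewrite -natr_sum; congr _%:R.
rewrite /axis_walks (big_cat_nat _ nN) //= [X in (_ + X)%N]big_nat_cond.
rewrite [X in (_ + X)%N]big1 ?addn0 // => i; rewrite andbT => /andP[ni _].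
exact: q_gt.
Unshelve. all: by end_near. Qed.

Theorem proposition3p4 (R : realType) :
  (\big[+%R/0]_(0 <= i <oo) ((q i 0 n)%:R : R)) /
    (8 / pi * (4 ^+ n / n%:R ^+ 2)) @[n --> \oo] --> (1 : R).
Proof.
have lo : 1 - 5 / n.+1%:R @[n --> \oo] --> (1 : R).
  rewrite -[X in _ --> X](subr0 1) -(mulr0 5).
  apply: cvgB; first exact: cvg_cst.
  by apply: cvgMr; exact: cvg_harmonic.
apply: (squeeze_cvgr _ lo); last exact: (cvg_cst (1 : R)).
near=> n.
rewrite axis_walks_series; apply: axis_ratio_bounds.
by near: n; exact: nbhs_infty_gt.
Unshelve. all: by end_near. Qed.
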